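(* Let $G=(V,E)$ be a connected undirected graph with $|V|=n\ge 2$ and valuations $(f_v)_{v\in V}$. Suppose we are given a (possibly partial) allocation $\{A_v\}_{v\in V}$ with residue $R=[0,1]\setminus\bigcup_v A_v$ that is locally proportional on $G$, and an agent $r\in V$ that is dominant with respect to this allocation and residue. Run the DiffuseDominance procedure: set $D=\{r\}$; while $D\ne V$, pick an agent $v\in V\setminus D$ adjacent to some agent of $D$, run $\mathrm{Core}(v, V\setminus D, \cdot)$ $K_v$ times in succession, each time on the current residue and adding each agent's returned piece to her current share, where $K_v=\lceil (m-2)\ln 3\rceil$ if $m=|V\setminus D|\ge 3$ and $K_v=1$ if $m=2$; then set $D=D\cup\{v\}$. Then this procedure produces a complete allocation of the cake that is locally proportional on $G$, using $O(n^2)$ calls of the Core Protocol.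
   Context: Cake $[0,1]$; a piece is a finite union of disjoint subintervals. Each valuation $f_v$ is nonnegative, normalized ($f_v([0,1])=1$), additive and divisible (for every interval $I$ and $\lambda\in[0,1]$ there is an interval $I'\subseteq I$ with $f_v(I')=\lambda f_v(I)$). An allocation is a family $\{A_v\}$ of pairwise disjoint pieces; it is partial if their union is not the whole cake, and the unallocated part is the residue. $N(v)$ denotes the neighbors of $v$, $d_v=|N(v)|$. The allocation is locally proportional if $f_v(A_v)\ge \frac{1}{d_v}\sum_{u\in N(v)}f_v(A_u)$ for all $v$. Given allocation $\{A_v\}$ and residue $R$, agent $v$ is dominant if $f_v(A_v)\ge \frac{1}{d_v}\big(\sum_{u\in N(v)}f_v(A_u)+f_v(R)\big)$. The Core Protocol $\mathrm{Core}(c,N,R)$ (due to Aziz and Mackenzie), for a set of agents $N$, a cutter $c\in N$ and a residue $R$, with $m=|N|$: the cutter $c$ cuts $R$ into $m$ pieces of equal value to her; the protocol returns disjoint pieces $X_w\subseteq R$ ($X_w=\emptyset$ for $w\notin N$) such that each $w\in N$ receives a subset of exactly one of the $m$ pieces (different agents, different pieces), the cutter and at least one other agent each receive a complete piece, and $f_w(X_w)\ge f_w(X_{w'})$ for all $w,w'\in N$; the new residue is $R'=R\setminus\bigcup_w X_w$. When $m=2$ it is cut-and-choose and $R'=\emptyset$.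
   Formalization: The statement leaves K_v and Core undefined when m=|V∖D|=1, which is always the last iteration; here K_v=1 in that case, and Core with a single agent gives that agent the whole current residue. *)

(* Defs.v *)
From mathcomp Require Import all_boot all_order all_algebra.
From mathcomp Require Import all_classical all_reals all_analysis.

Set Implicit Arguments.
Unset Strict Implicit.
Unset Printing Implicit Defensive.

Import Order.TTheory GRing.Theory Num.Theory.
Local Open Scope classical_set_scope.
Local Open Scope ring_scope.

Definition cake (R : realType) : set R := `[0, 1].
Arguments cake : clear implicits.

(* Intervals may be open, closed or half-open, degenerate or empty, so that a
   piece can be cut into pieces that are disjoint as sets, endpoints included. *)
Definition is_piece (R : realType) (A : set R) : Prop :=
  exists (k : nat) (I : 'I_k -> interval R),
    [/\ forall j, [set` I j] `<=` cake R,
        trivIset setT (fun j => [set` I j])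
      & A = \bigcup_j [set` I j] ].

(* A valuation is only constrained on pieces; its values elsewhere are never
   used. *)
Definition is_valuation (R : realType) (f : set R -> R) : Prop :=
  [/\ forall A, is_piece A -> 0 <= f A,
      f (cake R) = 1,
      forall A B, is_piece A -> is_piece B -> A `&` B = set0 ->
        f (A `|` B) = f A + f B
    & forall (I : interval R) (lambda : R), [set` I] `<=` cake R ->
        0 <= lambda <= 1 ->
        exists I' : interval R,
          [set` I'] `<=` [set` I] /\ f [set` I'] = lambda * f [set` I] ].

Definition is_allocation (R : realType) (V : finType) (A : V -> set R) : Prop :=
  (forall v, is_piece (A v)) /\ trivIset setT A.

Definition residue (R : realType) (V : finType) (A : V -> set R) : set R :=
  cake R `\` \bigcup_v A v.

Definition is_complete (R : realType) (V : finType) (A : V -> set R) : Prop :=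
  \bigcup_v A v = cake R.

Definition connected_graph (V : finType) (e : rel V) : Prop :=
  [/\ symmetric e, irreflexive e & forall u v, connect e u v].

Definition nbrs (V : finType) (e : rel V) (v : V) : {set V} :=
  [set u | e v u]%SET.

Definition locally_proportional (R : realType) (V : finType) (e : rel V)
    (f : V -> set R -> R) (A : V -> set R) : Prop :=
  forall v, f v (A v) >=
    #|nbrs e v|%:R^-1 * \sum_(u in nbrs e v) f v (A u).

Definition dominant (R : realType) (V : finType) (e : rel V)
    (f : V -> set R -> R) (A : V -> set R) (v : V) : Prop :=
  f v (A v) >=
    #|nbrs e v|%:R^-1 * (\sum_(u in nbrs e v) f v (A u) + f v (residue A)).

(* X is an admissible result of Core(c, N, S). The family P lists the #|N|
   pieces cut by c and sigma w is the index of the piece in which w's share lies.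
   If #|N| = 2, the completeness clauses force X to exhaust S (cut-and-choose).
   If #|N| = 1 there is no other agent, and the cutter receives all of S. *)
Definition core_outcome (R : realType) (V : finType) (f : V -> set R -> R)
    (c : V) (N : {set V}) (S : set R) (X : V -> set R) : Prop :=
  [/\ forall w, is_piece (X w),
      forall w, w \notin N -> X w = set0,
      {in N &, forall w w', f w (X w) >= f w (X w')}
    & exists (P : 'I_#|N| -> set R) (sigma : V -> 'I_#|N|),
      [/\ [/\ forall i, is_piece (P i),
              trivIset setT P,
              \bigcup_i P i = S
            & forall i j, f c (P i) = f c (P j)],
          {in N &, injective sigma},
          {in N, forall w, X w `<=` P (sigma w)},
          X c = P (sigma c)
        & (2 <= #|N|)%N ->
          exists w, [/\ w \in N, w != c & X w = P (sigma w)]] ].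

Definition is_core_protocol (R : realType) (V : finType) (f : V -> set R -> R)
    (core : V -> {set V} -> set R -> V -> set R) : Prop :=
  forall (c : V) (N : {set V}) (S : set R), c \in N -> is_piece S ->
    core_outcome f c N S (core c N S).

Fixpoint iter_core (R : realType) (V : finType)
    (core : V -> {set V} -> set R -> V -> set R) (k : nat)
    (c : V) (N : {set V}) (A : V -> set R) : V -> set R :=
  if k is k'.+1 then
    iter_core core k' c N (fun w => A w `|` core c N (residue A) w)
  else A.

(* The value for m = 1, which occurs for the last agent, is a convention: a
   single call hands her whatever residue is left. *)
Definition num_calls (R : realType) (m : nat) : nat :=
  if (3 <= m)%N then `|Num.ceil ((m - 2)%:R * ln 3 : R)|%N else 1%N.

Record dd_state (R : realType) (V : finType) := DDState {
  dd_dom : {set V};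
  dd_alloc : V -> set R;
  dd_calls : nat
}.

Inductive dd_step (R : realType) (V : finType) (e : rel V)
    (core : V -> {set V} -> set R -> V -> set R) :
    dd_state R V -> dd_state R V -> Prop :=
| DDStep (s : dd_state R V) (u v : V) :
    u \in dd_dom s -> v \notin dd_dom s -> e u v ->
    let N := (~: dd_dom s)%SET in
    let K := num_calls R #|N| in
    dd_step e core s
      (DDState (v |: dd_dom s)%SET (iter_core core K v N (dd_alloc s))
               (dd_calls s + K)).

(* Total correctness of the nondeterministic while loop: whatever agents are
   picked, the loop never gets stuck, terminates, and ends in a state
   satisfying Q. *)
Inductive dd_produces (R : realType) (V : finType) (e : rel V)
    (core : V -> {set V} -> set R -> V -> set R) (Q : dd_state R V -> Prop) :
    dd_state R V -> Prop :=
| DDStop s : dd_dom s = [set: V]%SET -> Q s -> dd_produces e core Q s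
| DDLoop s : dd_dom s <> [set: V]%SET ->
    (exists s', dd_step e core s s') ->
    (forall s', dd_step e core s s' -> dd_produces e core Q s') ->
    dd_produces e core Q s.

(* Main.v *)
Require Import Defs.
From mathcomp Require Import all_boot all_order all_algebra.
From mathcomp Require Import all_classical all_reals all_analysis.
From mathcomp Require Import ring lra zify.

Set Implicit Arguments.
Unset Strict Implicit.
Unset Printing Implicit Defensive.

Import Order.TTheory GRing.Theory Num.Theory.
Local Open Scope classical_set_scope.
Local Open Scope ring_scope.

(** Invariant of the loop: the allocation is locally proportional and every
    agent of D is dominant.  The agents of N = V \ D do not envy anybody for a
    piece handed out by Core, so they stay locally proportional; the pieces come
    out of the residue, so the agents of D stay dominant.  The cutter v has a
    neighbour in D, who gets nothing: hence each call adds at least f_v(X_v) =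
    f_v(R)/m to her surplus d_v f_v(A_v) - sum_(u in N(v)) f_v(A_u), while two
    complete pieces leave the residue, whose value drops by a factor
    t = m/(m-2).  After K calls the surplus exceeds (t^K - 1)/2 times the
    remaining value, which suffices once t^K >= 3; this holds for
    K >= (m-2) ln 3.  The last cutter is alone in N and takes the whole
    residue.  Finally K_v <= 2m, so at most 2n^2 calls are made. *)

(** * Pieces *)

Lemma is_piece0 (R : realType) : is_piece (set0 : set R).
Proof.
exists 0%N, (fun _ => `]0, 0[); split=> [[]|[]|] //.
by apply/esym/seteqP; split=> x // [[]].
Qed.

Lemma bigcup_ordS (T : Type) (k : nat) (F : 'I_k.+1 -> set T) :
  \bigcup_j F j = F ord0 `|` \bigcup_j F (lift ord0 j).
Proof.
apply/seteqP; split=> x.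
  by case=> j _; case: (unliftP ord0 j) => [i|] -> Fx; [right; exists i|left].
by case=> [Fx|[i _ Fx]]; [exists ord0|exists (lift ord0 i)].
Qed.

Lemma is_piece_itvU (R : realType) (I : interval R) (B : set R) :
  [set` I] `<=` cake R -> is_piece B -> [set` I] `&` B = set0 ->
  is_piece ([set` I] `|` B).
Proof.
move=> sI [k [J [sJ tJ ->]]] dIJ.
pose F j := if unlift ord0 j is Some i then J i else I.
have F0 : F ord0 = I by rewrite /F unlift_none.
have FS i : F (lift ord0 i) = J i by rewrite /F liftK.
have dI i x : [set` I] x -> [set` J i] x -> False.
  by move=> Ix Jx; suff: (set0 : set R) x by []; rewrite -dIJ; split=> //; exists i.
exists k.+1, F; split.
- by move=> j; case: (unliftP ord0 j) => [i|] ->; rewrite ?FS ?F0.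
- move=> a b _ _ [x []].
  case: (unliftP ord0 a) => [i|] ->; case: (unliftP ord0 b) => [j|] ->;
    rewrite ?FS ?F0 // => xa xb.
  + by rewrite (tJ i j) //; exists x.
  + by case: (dI i x).
  + by case: (dI j x).
- by rewrite bigcup_ordS F0; under [in RHS]eq_bigcupr do rewrite FS.
Qed.

Lemma is_piece_itv (R : realType) (I : interval R) :
  [set` I] `<=` cake R -> is_piece [set` I].
Proof.
move=> sI; rewrite -[X in is_piece X]setU0; apply: is_piece_itvU => //.
  exact: is_piece0.
exact: setI0.
Qed.

(** Treats pieces as generated from the empty set by adjoining one disjoint interval at a time,
    which keeps indexed families out of the closure proofs below. *)
Lemma piece_ind (R : realType) (Q : set R -> Prop) :
  Q set0 ->
  (forall (I : interval R) B, [set` I] `<=` cake R -> is_piece B ->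
     [set` I] `&` B = set0 -> Q B -> Q ([set` I] `|` B)) ->
  forall A, is_piece A -> Q A.
Proof.
move=> Q0 QU A [k [J [sJ tJ ->]]] {A}.
elim: k J sJ tJ => [|k IHk] J sJ tJ.
  by rewrite (_ : \bigcup_j _ = set0) //; apply/seteqP; split=> x // [[]].
have tJ' : trivIset setT (fun j => [set` J (lift ord0 j)]).
  by move=> a b _ _ /(tJ _ _ I I) /lift_inj.
rewrite bigcup_ordS; apply: QU => //; last by apply: IHk.
- by exists k, (fun j => J (lift ord0 j)).
- apply/seteqP; split=> x // [J0 [i _ Ji]].
  by have /eqP := tJ ord0 (lift ord0 i) I I (ex_intro _ x (conj J0 Ji)).
Qed.

Lemma is_piece_subcake (R : realType) (A : set R) : is_piece A -> A `<=` cake R.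
Proof. by case=> k [J [sJ _ ->]] x [j _ /sJ]. Qed.

Lemma is_pieceU (R : realType) (A B : set R) :
  is_piece A -> is_piece B -> A `&` B = set0 -> is_piece (A `|` B).
Proof.
move=> pA pB; elim/piece_ind: pA => [|I A' sI pA' dI IH dAB]; first by rewrite set0U.
move: dAB; rewrite setIUl setU_eq0 => -[dIB dAB].
rewrite -setUA; apply: is_piece_itvU => //; first exact: IH.
by rewrite setIUr dI dIB setU0.
Qed.

Lemma is_piece_itvD (R : realType) (I J : interval R) :
  [set` I] `<=` cake R -> is_piece ([set` I] `\` [set` J]).
Proof.
move=> sI; pose L := Interval -oo%O J.1.
(* The complement of [J] is a left ray and a right ray. If [J] is empty these may overlap, so the
   right one is also cut at [J.1], which makes the two parts disjoint. *)
have -> : [set` I] `\` [set` J] = [set` (I `&` L)%O] `|`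
    [set` ((I `&` Interval J.1 +oo) `&` Interval J.2 +oo)%O].
  rewrite !itv_setI setDE setCitv -(setCitvl J.1) -/L.
  apply/seteqP; split=> x.
    case=> Ix [Lx|Ux]; first by left.
    by have [Lx|nLx] := pselect ([set` L] x); [left|right].
  by case=> [[Ix Lx]|[[Ix _] Ux]]; split=> //; [left|right].
apply: is_pieceU.
- by apply: is_piece_itv; rewrite itv_setI => x [/sI].
- by apply: is_piece_itv; rewrite !itv_setI => x [[/sI]].
- by rewrite !itv_setI -(setCitvl J.1) -/L; apply/seteqP; split=> x // [[_ Lx] [[_ /(_ Lx)]]].
Qed.

(** Induction on [B] removes one interval at a time, with [A] left general; a second induction, on
    [A], reduces to a difference of two intervals. *)
Lemma is_pieceD (R : realType) (A B : set R) :
  is_piece A -> is_piece B -> is_piece (A `\` B).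
Proof.
move=> pA pB; elim/piece_ind: pB A pA => [A'|J B' sJ pB' dJ IH A' pA']; first by rewrite setD0.
rewrite -setDDl; apply: IH; elim/piece_ind: pA' => [|I A'' sI pA'' dI IH].
  by rewrite set0D; exact: is_piece0.
rewrite setDUl; apply: is_pieceU => //; first exact: is_piece_itvD.
apply/seteqP; split=> x // [[Ix _] [Ax _]].
by suff: (set0 : set R) x by []; rewrite -dI.
Qed.

Lemma is_piece_cake (R : realType) : is_piece (cake R).
Proof. exact: is_piece_itv. Qed.

Lemma bigcup_fintypeE (T : Type) (V : finType) (A : V -> set T) :
  \bigcup_v A v = \big[setU/set0]_v A v.
Proof.
rewrite -bigcup_seq; congr bigcup.
by apply/seteqP; split=> v //= _; rewrite mem_index_enum.
Qed.

Lemma setI_bigsetU0 (T : Type) (V : finType) (A : V -> set T) (v : V)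
    (s : seq V) :
  trivIset setT A -> v \notin s -> A v `&` \big[setU/set0]_(u <- s) A u = set0.
Proof.
move=> tA vs; apply/seteqP; split=> x //; rewrite -bigcup_seq => -[Av [u /= us Au]].
by move: vs; rewrite (tA v u) ?us //; exists x.
Qed.

Lemma is_piece_bigsetU (R : realType) (V : finType) (A : V -> set R)
    (s : seq V) :
  (forall v, is_piece (A v)) -> trivIset setT A -> uniq s ->
  is_piece (\big[setU/set0]_(v <- s) A v).
Proof.
move=> pA tA; elim: s => [_|v s IH /= /andP[vs us]].
  by rewrite big_nil; exact: is_piece0.
by rewrite big_cons; apply: is_pieceU => //; [exact: IH|exact: setI_bigsetU0].
Qed.

Lemma is_piece_bigcup (R : realType) (V : finType) (A : V -> set R) :
  is_allocation A -> is_piece (\bigcup_v A v).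
Proof.
case=> pA tA; rewrite bigcup_fintypeE.
by apply: is_piece_bigsetU => //; exact: index_enum_uniq.
Qed.

Lemma is_piece_residue (R : realType) (V : finType) (A : V -> set R) :
  is_allocation A -> is_piece (residue A).
Proof.
by move=> aA; apply: is_pieceD (is_piece_bigcup aA); exact: is_piece_cake.
Qed.

(** * Valuations *)

Lemma valuation_ge0 (R : realType) (f : set R -> R) (A : set R) :
  is_valuation f -> is_piece A -> 0 <= f A.
Proof. by case=> + _ _ _; apply. Qed.

Lemma valuationU (R : realType) (f : set R -> R) (A B : set R) :
  is_valuation f -> is_piece A -> is_piece B -> A `&` B = set0 ->
  f (A `|` B) = f A + f B.
Proof. by case=> _ _ + _; apply. Qed.

Lemma valuation0 (R : realType) (f : set R -> R) :
  is_valuation f -> f set0 = 0.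
Proof.
move=> vf; have p0 := is_piece0 R.
have := valuationU vf p0 p0 (setI0 _); rewrite setU0 => f0; lra.
Qed.

Lemma valuation_bigU (R : realType) (V : finType) (f : set R -> R)
    (A : V -> set R) :
  is_valuation f -> (forall v, is_piece (A v)) -> trivIset setT A ->
  f (\bigcup_v A v) = \sum_v f (A v).
Proof.
move=> vf pA tA; rewrite bigcup_fintypeE.
elim: (index_enum V) (index_enum_uniq V) => [_|v s IH /= /andP[vs us]].
  by rewrite !big_nil; exact: valuation0.
rewrite !big_cons valuationU // ?IH //; first exact: is_piece_bigsetU.
exact: setI_bigsetU0.
Qed.

(** Additivity and normalization turn later statements about the residue into arithmetic on the
    shares. *)
Lemma valuation_residue (R : realType) (V : finType) (f : set R -> R)
    (A : V -> set R) :
  is_valuation f -> is_allocation A -> f (residue A) = 1 - \sum_v f (A v).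
Proof.
move=> vf aA; have [pA tA] := aA; rewrite -(valuation_bigU vf pA tA).
have pR := is_piece_residue aA.
have pU := is_piece_bigcup aA.
have d : residue A `&` \bigcup_v A v = set0.
  by apply/seteqP; split=> x // [[_ nU] /nU].
have cakeE : residue A `|` \bigcup_v A v = cake R.
  by rewrite setUC setDUK // => x [v _ /(is_piece_subcake (pA v))].
have f1 : f (cake R) = 1 by case: vf.
by rewrite -f1 -cakeE valuationU // addrK.
Qed.

(** * One call of the Core Protocol *)

Definition add_shares {R : realType} {V : finType} (A X : V -> set R) : V -> set R :=
  fun w => A w `|` X w.

Lemma core_outcome_sub (R : realType) (V : finType) (f : V -> set R -> R)
    (c : V) (N : {set V}) (S : set R) (X : V -> set R) (w : V) :
  core_outcome f c N S X -> X w `<=` S.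
Proof.
case=> _ X0 _ [P [sigma [[_ _ <- _] _ XP _ _]]].
have [wN|/X0 ->] := boolP (w \in N); last exact: sub0set.
by move=> x /(XP _ wN) Px; exists (sigma w).
Qed.

Lemma core_outcome_trivIset (R : realType) (V : finType) (f : V -> set R -> R)
    (c : V) (N : {set V}) (S : set R) (X : V -> set R) :
  core_outcome f c N S X -> trivIset setT X.
Proof.
case=> _ X0 _ [P [sigma [[_ tP _ _] inj XP _ _]]] a b _ _ [x [Xa Xb]].
have [aN|/X0 Xa0] := boolP (a \in N); last by rewrite Xa0 in Xa.
have [bN|/X0 Xb0] := boolP (b \in N); last by rewrite Xb0 in Xb.
apply: inj => //; apply: tP => //; exists x.
by split; apply: XP.
Qed.

(** Envy-freeness extends to agents [u] outside [N] because they receive the empty set. *)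
Lemma core_outcome_ge (R : realType) (V : finType) (f : V -> set R -> R)
    (c : V) (N : {set V}) (S : set R) (X : V -> set R) (w u : V) :
  (forall v, is_valuation (f v)) -> core_outcome f c N S X ->
  w \in N -> f w (X u) <= f w (X w).
Proof.
move=> vf [pX X0 ef _] wN; have [uN|/X0 ->] := boolP (u \in N); first exact: ef.
by rewrite valuation0 // valuation_ge0.
Qed.

(** The cutter holds one complete piece out of [#|N|] pieces that she values equally and that
    exhaust [S]. *)
Lemma core_cutter_share (R : realType) (V : finType) (f : V -> set R -> R)
    (c : V) (N : {set V}) (S : set R) (X : V -> set R) :
  (forall v, is_valuation (f v)) -> core_outcome f c N S X ->
  #|N|%:R * f c (X c) = f c S.
Proof.
move=> vf [_ _ _ [P [sigma [[pP tP <- eqP] _ _ -> _]]]].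
rewrite valuation_bigU // (eq_bigr (fun _ => f c (P (sigma c)))).
  by rewrite sumr_const card_ord mulr_natl.
by move=> i _; exact: eqP.
Qed.

(** The second complete piece is worth as much to the cutter as her own. *)
Lemma core_two_shares (R : realType) (V : finType) (f : V -> set R -> R)
    (c : V) (N : {set V}) (S : set R) (X : V -> set R) :
  (forall v, is_valuation (f v)) -> c \in N -> (2 <= #|N|)%N ->
  core_outcome f c N S X ->
  2 * f c (X c) <= \sum_w f c (X w).
Proof.
move=> vf cN N2 [pX _ _ [P [sigma [[_ _ _ eqP] _ _ Xc /(_ N2)[w [wN wc Xw]]]]]].
rewrite (bigD1 c) //= (bigD1 w) //= addrA.
have -> : f c (X w) = f c (X c) by rewrite Xw Xc.
have : 0 <= \sum_(i | (i != c) && (i != w)) f c (X i).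
  by apply: sumr_ge0 => i _; apply: valuation_ge0.
lra.
Qed.

Lemma is_allocation_add_shares (R : realType) (V : finType) (f : V -> set R -> R)
    (c : V) (N : {set V}) (A X : V -> set R) :
  is_allocation A -> core_outcome f c N (residue A) X ->
  is_allocation (add_shares A X).
Proof.
move=> [pA tA] oX; have sX w : X w `<=` residue A := core_outcome_sub oX.
have tX := core_outcome_trivIset oX.
have dAX u w x : A u x -> X w x -> False.
  by move=> Au /sX[_]; apply; exists u.
split.
  move=> w; apply: is_pieceU => //; first by case: oX.
  by apply/seteqP; split=> x // [Aw Xw]; case: (dAX w w x).
move=> a b _ _ [x [[Aa|Xa] [Ab|Xb]]].
- by apply: tA => //; exists x.
- by case: (dAX a b x).
- by case: (dAX b a x).
- by apply: tX => //; exists x.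
Qed.

Lemma valuation_add_shares (R : realType) (V : finType) (f : V -> set R -> R)
    (c : V) (N : {set V}) (A X : V -> set R) (v w : V) :
  (forall v, is_valuation (f v)) -> is_allocation A ->
  core_outcome f c N (residue A) X ->
  f v (add_shares A X w) = f v (A w) + f v (X w).
Proof.
move=> vf [pA tA] oX; apply: valuationU => //; first by case: oX.
apply/seteqP; split=> x // [Aw /(core_outcome_sub oX)[_]].
by apply; exists w.
Qed.

Lemma valuation_residue_add_shares (R : realType) (V : finType)
    (f : V -> set R -> R) (c : V) (N : {set V}) (A X : V -> set R) (v : V) :
  (forall v, is_valuation (f v)) -> is_allocation A ->
  core_outcome f c N (residue A) X ->
  f v (residue (add_shares A X)) = f v (residue A) - \sum_w f v (X w).
Proof.
move=> vf aA oX; have aAX := is_allocation_add_shares aA oX.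
rewrite !valuation_residue //.
under eq_bigr do rewrite (valuation_add_shares _ _ vf aA oX).
by rewrite big_split /= opprD addrA.
Qed.

(** * Dominance *)

(** Stated agent by agent, since inside and outside [N] the property survives for different
    reasons. *)
Definition loc_prop_at {R : realType} {V : finType} (e : rel V)
    (f : V -> set R -> R) (A : V -> set R) (v : V) : Prop :=
  #|nbrs e v|%:R^-1 * \sum_(u in nbrs e v) f v (A u) <= f v (A v).

Lemma dominant_loc_prop (R : realType) (V : finType) (e : rel V)
    (f : V -> set R -> R) (A : V -> set R) (v : V) :
  (forall v, is_valuation (f v)) -> is_allocation A ->
  dominant e f A v -> loc_prop_at e f A v.
Proof.
move=> vf aA; apply: le_trans; apply: ler_wpM2l; first by rewrite invr_ge0.
by rewrite lerDl valuation_ge0 //; apply: is_piece_residue.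
Qed.

(** What the neighbours gain is at most what the residue loses, and the share of [v] does not lose
    value. *)
Lemma dominant_add_shares (R : realType) (V : finType) (e : rel V)
    (f : V -> set R -> R) (c : V) (N : {set V}) (A X : V -> set R) (v : V) :
  (forall v, is_valuation (f v)) -> is_allocation A ->
  core_outcome f c N (residue A) X ->
  dominant e f A v -> dominant e f (add_shares A X) v.
Proof.
move=> vf aA oX; have pX w : is_piece (X w) by case: oX.
rewrite /dominant (valuation_add_shares _ _ vf aA oX) => dA.
have : f v (A v) <= f v (A v) + f v (X v) by rewrite lerDl valuation_ge0.
apply: le_trans; apply: le_trans dA; apply: ler_wpM2l; first by rewrite invr_ge0.
under eq_bigr do rewrite (valuation_add_shares _ _ vf aA oX).
rewrite (valuation_residue_add_shares _ vf aA oX) big_split /=.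
have : \sum_(i in nbrs e v) f v (X i) <= \sum_w f v (X w).
  rewrite [leRHS](bigID (mem (nbrs e v))) /= lerDl.
  by apply: sumr_ge0 => i _; apply: valuation_ge0.
lra.
Qed.

Lemma loc_prop_add_shares (R : realType) (V : finType) (e : rel V)
    (f : V -> set R -> R) (c : V) (N : {set V}) (A X : V -> set R) (v : V) :
  (forall v, is_valuation (f v)) -> is_allocation A ->
  core_outcome f c N (residue A) X -> v \in N ->
  loc_prop_at e f A v -> loc_prop_at e f (add_shares A X) v.
Proof.
move=> vf aA oX vN lA; have pX w : is_piece (X w) by case: oX.
rewrite /loc_prop_at (valuation_add_shares _ _ vf aA oX).
under eq_bigr do rewrite (valuation_add_shares _ _ vf aA oX).
rewrite big_split /= mulrDr; apply: lerD => //.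
(* For degree 0 the inverse is 0 by convention, so only nonnegativity is left. *)
have [->|d0] := posnP #|nbrs e v|; first by rewrite invr0 mul0r valuation_ge0.
rewrite ler_pdivrMl ?ltr0n // mulr_natl -sumr_const.
by apply: ler_sum => u _; apply: core_outcome_ge oX vN.
Qed.

Lemma dominant_residue0 (R : realType) (V : finType) (e : rel V)
    (f : V -> set R -> R) (A : V -> set R) (v : V) :
  f v (residue A) <= 0 -> loc_prop_at e f A v -> dominant e f A v.
Proof.
move=> r0; apply: le_trans; apply: ler_wpM2l; first by rewrite invr_ge0.
lra.
Qed.

(** * Iterated calls *)

(** Being an allocation is carried along with [Q], since each call needs its residue to be a
    piece. *)
Lemma iter_core_ind (R : realType) (V : finType) (f : V -> set R -> R)
    (core : V -> {set V} -> set R -> V -> set R) (c : V) (N : {set V})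
    (Q : (V -> set R) -> Prop) (k : nat) (A : V -> set R) :
  is_core_protocol f core -> c \in N ->
  (forall B X, is_allocation B -> core_outcome f c N (residue B) X ->
     Q B -> Q (add_shares B X)) ->
  is_allocation A -> Q A ->
  is_allocation (iter_core core k c N A) /\ Q (iter_core core k c N A).
Proof.
move=> hcore cN step; elim: k A => [//|k IH] A aA QA /=.
have oX := hcore c N _ cN (is_piece_residue aA).
by apply: IH; [exact: (is_allocation_add_shares aA oX)|exact: step oX QA].
Qed.

(** Division-free measure: at positive degree, local proportionality at [v] says that it is
    nonnegative, dominance that it is at least the value of the residue. *)
Definition surplus {R : realType} {V : finType} (e : rel V)
    (f : V -> set R -> R) (A : V -> set R) (v : V) : R :=
  #|nbrs e v|%:R * f v (A v) - \sum_(u in nbrs e v) f v (A u).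

(* The neighbour u outside N receives nothing, so the cutter gains a full share
   on her d_v neighbours. *)
Lemma surplus_add_shares (R : realType) (V : finType) (e : rel V)
    (f : V -> set R -> R) (c u : V) (N : {set V}) (A X : V -> set R) :
  (forall v, is_valuation (f v)) -> is_allocation A ->
  core_outcome f c N (residue A) X -> c \in N -> u \notin N -> e c u ->
  surplus e f A c + f c (X c) <= surplus e f (add_shares A X) c.
Proof.
move=> vf aA oX cN uN cu; have pX w : is_piece (X w) by case: oX.
have Xu : X u = set0 by case: oX => _ + _ _; apply.
rewrite /surplus (valuation_add_shares _ _ vf aA oX).
under [in leRHS]eq_bigr do rewrite (valuation_add_shares _ _ vf aA oX).
rewrite big_split /= mulrDr.
have ucN : u \in nbrs e c by rewrite inE.
have : \sum_(i in nbrs e c) f c (X i) + f c (X c) <= #|nbrs e c|%:R * f c (X c).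
  rewrite mulr_natl -sumr_const (bigD1 u) //= [leRHS](bigD1 u) //= Xu valuation0 //.
  rewrite add0r [leLHS]addrC lerD2l.
  by apply: ler_sum => w _; apply: core_outcome_ge oX cN.
lra.
Qed.

(* With t = m/(m-2), each call divides the cutter's value of the residue by at
   least t and adds a 1/m fraction of it to her surplus; summing the geometric
   series gives the factor (t^k - 1)/2. *)
Lemma iter_core_surplus (R : realType) (V : finType) (e : rel V)
    (f : V -> set R -> R) (core : V -> {set V} -> set R -> V -> set R)
    (c u : V) (N : {set V}) (j k : nat) (A : V -> set R) :
  (forall v, is_valuation (f v)) -> is_core_protocol f core ->
  c \in N -> u \notin N -> e c u -> #|N| = j.+3 -> is_allocation A ->
  let t := 1 + 2 / j.+1%:R in
  let B := iter_core core k c N A in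
  t ^+ k * f c (residue B) <= f c (residue A) /\
  surplus e f A c + (t ^+ k - 1) / 2 * f c (residue B) <= surplus e f B c.
Proof.
move=> vf hcore cN uN cu cardN + t; set p : R := j.+1%:R in t *.
elim: k A => [|k IH] A aA /=; first by rewrite expr0 subrr !mul0r mul1r addr0.
have oX := hcore c N _ cN (is_piece_residue aA).
set X := core c N (residue A) in oX *.
have aAX := is_allocation_add_shares aA oX.
have [] := IH _ aAX; rewrite -/(add_shares A X).
set B := iter_core core k c N _ => IHr IHs.
have sS := surplus_add_shares vf aA oX cN uN cu.
have rS := valuation_residue_add_shares c vf aA oX.
have cS := core_cutter_share vf oX.
have tS : 2 * f c (X c) <= \sum_w f c (X w).
  by apply: core_two_shares vf cN _ oX; rewrite cardN.
have j0 : 0 < p by rewrite ltr0n.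
have mE : (#|N|%:R : R) = p + 2 by rewrite cardN /p -natrD; congr _%:R; lia.
have t0 : 0 <= t by rewrite /t addr_ge0 // divr_ge0.
(* With [m = j.+3] and [p = m - 2], this is [t = m/(m-2)]. *)
have tj : t * p = p + 2 by rewrite /t mulrDl mul1r divfK ?lt0r_neq0.
set x := f c (X c) in sS cS tS.
have r1 : t * f c (residue (add_shares A X)) <= f c (residue A).
  apply: (@le_trans _ _ (t * (p * x))).
    apply: ler_wpM2l => //; rewrite rS -cS mE; lra.
  by rewrite mulrA tj -cS mE.
have r2 : t ^+ k.+1 * f c (residue B) <= f c (residue A).
  by apply: le_trans r1; rewrite exprS -mulrA; apply: ler_wpM2l.
split=> //.
apply: le_trans IHs.
apply: (@le_trans _ _
  (surplus e f A c + x + (t ^+ k - 1) / 2 * f c (residue B))); last first.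
  by rewrite lerD2r.
have r3 : t ^+ k * f c (residue B) <= p * x.
  rewrite -(ler_pM2l (_ : 0 < t)); last by rewrite /t ltr_pwDl // divr_ge0.
  by rewrite !mulrA -exprS tj -mE cS.
(* The factor [(t^k - 1)/2] grows by [t^k / p]; by [r4] the cutter's share [x] in the first call
   pays for this. *)
have -> : t ^+ k.+1 = t ^+ k + 2 / p * t ^+ k by rewrite exprS {1}/t mulrDl mul1r.
have r4 : t ^+ k * f c (residue B) / p <= x by rewrite ler_pdivrMr // [leRHS]mulrC.
set y := f c (residue B) in r4 *.
have -> : (t ^+ k + 2 / p * t ^+ k - 1) / 2 * y =
  (t ^+ k - 1) / 2 * y + t ^+ k * y / p by field; rewrite lt0r_neq0.
by rewrite -[leRHS]addrA lerD2l [leRHS]addrC lerD2l.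
Qed.

(** With [y = 1/(m-2)], the estimate [exp y <= 1 + 2y] gives [t^K >= exp (K y) >= 3], as
    [K y >= ln 3]. *)
Lemma num_calls_ge (R : realType) (j : nat) :
  (3 : R) <= (1 + 2 / j.+1%:R) ^+ num_calls R j.+3.
Proof.
have l3 : 0 < ln (3 : R) by rewrite ln_gt0 //; lra.
have j0 : (0 : R) < j.+1%:R by rewrite ltr0n.
rewrite /num_calls (_ : (j.+3 - 2)%N = j.+1); last by lia.
set K := `|_|%N.
have KE : (K%:R : R) = (Num.ceil (j.+1%:R * ln 3 : R))%:~R.
  rewrite /K natr_absz ger0_norm // ceil_ge0; apply: lt_trans (mulr_gt0 j0 l3); lra.
have Kge : j.+1%:R * ln 3 <= K%:R :> R by rewrite KE ceil_ge.
have t1 : 1 <= 1 + 2 / j.+1%:R :> R by rewrite lerDl divr_ge0.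
(* For [m = 3] one has [y = 1], outside the range [y <= 1/2] used below; there the base is 3 itself
   and [K >= 1] is enough. *)
case: j => [|j] in j0 K KE Kge t1 *.
  have K1 : (1 <= K)%N by rewrite -(ltr_nat R); apply: lt_le_trans Kge; rewrite mul1r.
  have -> : 1 + 2 / 1%:R = 3 :> R by field.
  by rewrite -{1}(expr1 (3 : R)) ler_weXn2l //; lra.
set y : R := j.+2%:R^-1.
have y0 : 0 < y by rewrite invr_gt0.
have y1 : y <= 2^-1 by rewrite lef_pV2 ?posrE // ler_nat.
(* From [exp (-y) >= 1 - y] and [(1 - y)(1 + 2y) >= 1], valid for [0 <= y <= 1/2]. *)
have ey : expR y <= 1 + 2 * y.
  have e1 : 1 - y <= expR (- y) by apply: expR_ge1Dx.
  have e2 : expR (- y) * expR y = 1 by rewrite -expRD addNr expR0.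
  have e0 := expR_gt0 y.
  nra.
apply: (@le_trans _ _ (expR y ^+ K)); last by rewrite lerXn2r ?nnegrE ?expR_ge0 //; lra.
rewrite -expRM_natl -{1}(@lnK R 3) ?posrE //.
by rewrite ler_expR -[leLHS](mulKf (lt0r_neq0 j0)) mulrC ler_pM2r.
Qed.

(** The bound [ln (1 + x) <= x] at [x = 2] gives [ln 3 <= 2]. *)
Lemma num_calls_le (R : realType) (m : nat) : (0 < m)%N -> (num_calls R m <= 2 * m)%N.
Proof.
move=> m0; rewrite /num_calls; case: ifP => m3; last by lia.
have l3 : 0 < ln (3 : R) by rewrite ln_gt0 //; lra.
have l3' : ln (3 : R) <= 2.
  have := @le_ln1Dx R 2; rewrite (_ : 1 + 2 = 3 :> R); last by lra.
  by apply; lra.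
have : Num.ceil ((m - 2)%:R * ln 3 : R) <= (2 * m)%N%:Z.
  rewrite ceil_le_int -pmulrn natrM mulrC; apply: ler_pM => //; first lra.
  by rewrite ler_nat; lia.
have : 0 <= Num.ceil ((m - 2)%:R * ln 3 : R).
  by rewrite ceil_ge0; apply: (@lt_le_trans _ _ 0); [lra|rewrite mulr_ge0 // ltW].
by case: (Num.ceil _) => n //=; rewrite lez_nat.
Qed.

(** For [#|N|] equal to 1 or 2 a single call leaves the cutter no value in the residue. Otherwise
    [t^K >= 3] makes the coefficient [(t^K - 1)/2] at least 1, so the surplus covers the residue. *)
Lemma iter_core_dominant (R : realType) (V : finType) (e : rel V)
    (f : V -> set R -> R) (core : V -> {set V} -> set R -> V -> set R)
    (c u : V) (N : {set V}) (A : V -> set R) :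
  (forall v, is_valuation (f v)) -> is_core_protocol f core ->
  c \in N -> u \notin N -> e c u -> is_allocation A -> loc_prop_at e f A c ->
  dominant e f (iter_core core (num_calls R #|N|) c N A) c.
Proof.
move=> vf hcore cN uN cu aA lA.
have [aB lB] := iter_core_ind (Q := fun B => loc_prop_at e f B c)
  (num_calls R #|N|) hcore cN (fun B X aB oX => loc_prop_add_shares vf aB oX cN) aA lA.
have m0 : (0 < #|N|)%N by apply/card_gt0P; exists c.
have oX := hcore c N _ cN (is_piece_residue aA).
have cS := core_cutter_share vf oX.
have rS := valuation_residue_add_shares c vf aA oX.
have pX w : is_piece (core c N (residue A) w) by case: oX.
case mE : #|N| m0 aB lB cS => [//|[|[|j]]] _ aB lB cS.
- apply: dominant_residue0 lB; rewrite /= -/(add_shares _ _) rS -cS mul1r.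
  rewrite (bigD1 c) //= opprD addrA subrr add0r oppr_le0.
  by apply: sumr_ge0 => i _; apply: valuation_ge0.
- apply: dominant_residue0 lB; rewrite /= -/(add_shares _ _) rS -cS subr_le0.
  by apply: core_two_shares vf cN _ oX; rewrite mE.
- have [_] := iter_core_surplus (num_calls R j.+3) vf hcore cN uN cu mE aA.
  set B := iter_core _ _ _ _ _ in aB *; set t := _ ^+ _ => sB.
  have d0 : (0 : R) < #|nbrs e c|%:R.
    by rewrite ltr0n; apply/card_gt0P; exists u; rewrite inE.
  have s0 : 0 <= surplus e f A c.
    by rewrite subr_ge0 -ler_pdivrMl.
  rewrite /dominant ler_pdivrMl // -lerBrDl.
  apply: le_trans sB; apply: ler_wpDl => //.
  rewrite -[leLHS]mul1r; apply: ler_wpM2r.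
    by apply: valuation_ge0 => //; apply: is_piece_residue.
  have := num_calls_ge R j; rewrite -/t; lra.
Qed.

(* A lone cutter receives the whole residue. *)
Lemma iter_core_complete (R : realType) (V : finType) (f : V -> set R -> R)
    (core : V -> {set V} -> set R -> V -> set R) (c : V) (N : {set V})
    (A : V -> set R) :
  is_core_protocol f core -> c \in N -> #|N| = 1%N -> is_allocation A ->
  is_complete (iter_core core (num_calls R #|N|) c N A).
Proof.
move=> hcore cN N1 aA; have pR := is_piece_residue aA.
have oX := hcore c N _ cN pR; rewrite N1 /= -/(add_shares _ _).
have [pAX _] := is_allocation_add_shares aA oX.
have Xc : core c N (residue A) c = residue A.
  case: oX => _ _ _ [P [sigma [[_ _ + _] _ _ + _]]].
  (* The index type becomes ['I_1], so the only piece is the whole residue. *)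
  rewrite N1 in P sigma * => PE ->; rewrite -PE.
  apply/seteqP; split=> x; first by exists (sigma c).
  by case=> i _; rewrite (ord1 i) (ord1 (sigma c)).
apply/seteqP; split=> x; first by case=> w _ /(is_piece_subcake (pAX w)).
move=> cx; have [[w _ Aw]|nA] := pselect ((\bigcup_v A v) x).
  by exists w => //; left.
by exists c => //; right; rewrite Xc.
Qed.

(** * The diffusion loop *)

(** Without a crossing edge, [D] would be closed under adjacency and hence, by connectedness, be
    everything. This keeps the loop from getting stuck. *)
Lemma connected_crossing (V : finType) (e : rel V) (D : {set V}) (r : V) :
  connected_graph e -> r \in D -> D <> [set: V]%SET ->
  exists u v, [/\ u \in D, v \notin D & e u v].
Proof.
move=> [se _ ce] rD nD; apply: contrapT => ncross.
have clD : fingraph.closed e (mem D).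
  apply: intro_closed; first exact: sym_connect_sym.
  move=> x y xy xD; apply: contrapT => /negP yD.
  by apply: ncross; exists x, y.
apply: nD; apply/setP => v; rewrite inE.
by have := closed_connect clD (ce r v); rewrite /= rD => <-.
Qed.

Theorem theorem2 (R : realType) :
  exists C : nat,
  forall (V : finType) (e : rel V) (f : V -> set R -> R)
    (core : V -> {set V} -> set R -> V -> set R)
    (A : V -> set R) (r : V),
  (2 <= #|V|)%N ->
  connected_graph e ->
  (forall v, is_valuation (f v)) ->
  is_core_protocol f core ->
  is_allocation A ->
  locally_proportional e f A ->
  dominant e f A r ->
  dd_produces e core
    (fun s => [/\ is_allocation (dd_alloc s),
                  is_complete (dd_alloc s),
                  locally_proportional e f (dd_alloc s)
                & (dd_calls s <= C * #|V| ^ 2)%N])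
    (DDState [set r]%SET A 0).
Proof.
exists 2%N => V e f core A r V2 ge vf hcore aA lA dA.
(* The last conjunct is a potential argument: each agent still outside [D] holds a credit of
   [2 * #|V|] calls, enough for her turn as cutter. *)
pose inv (s : dd_state R V) :=
  [/\ r \in dd_dom s, is_allocation (dd_alloc s), locally_proportional e f (dd_alloc s),
      {in dd_dom s, forall v, dominant e f (dd_alloc s) v}
    & dd_dom s = [set: V]%SET -> is_complete (dd_alloc s)] /\
  (dd_calls s + 2 * (#|V| * #|(~: dd_dom s)%SET|) <= 2 * #|V| ^ 2)%N.
suff H s : inv s -> dd_produces e core
    (fun s => [/\ is_allocation (dd_alloc s), is_complete (dd_alloc s),
       locally_proportional e f (dd_alloc s) & (dd_calls s <= 2 * #|V| ^ 2)%N]) s.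
  apply: H; split; last first.
    by rewrite /= add0n -mulnn leq_mul2l leq_mul2l max_card orbT.
  split=> //=; first by rewrite inE.
    by move=> v; rewrite inE => /eqP ->.
  (* Initially completeness is vacuous: [D = [set r]] is not all of [V]. *)
  by move=> rT; move: V2; rewrite -cardsT -rT cards1.
have [n] := ubnP #|(~: dd_dom s)%SET|.
elim: n s => // n IH s sn [[rD aS lS dS cS] calls].
have [DT|DT] := pselect (dd_dom s = [set: V]%SET).
  by apply: DDStop => //; split=> //; [exact: cS|lia].
apply: DDLoop => //.
  have [u [v [uD vD uv]]] := connected_crossing ge rD DT.
  by eexists; exact: (DDStep core uD vD uv).
move=> s' st; case: st sn rD aS lS dS cS calls DT => {s s'}
  s u v uD vD uv N K sn rD aS lS dS cS calls DT.
have vN : v \in N by rewrite inE.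
have uN : u \notin N by rewrite inE negbK.
have vu : e v u by case: ge => -> .
have cN : #|N| = #|(~: (v |: dd_dom s))%SET|.+1.
  rewrite (cardsD1 v) vN add1n; congr _.+1; apply: eq_card => x.
  by rewrite !inE negb_or.
have domB w : w \in (v |: dd_dom s)%SET ->
    dominant e f (iter_core core K v N (dd_alloc s)) w.
  rewrite !inE => /orP[/eqP ->|wD].
    by apply: (iter_core_dominant vf hcore vN uN vu aS); apply: lS.
  by have [] := iter_core_ind (Q := fun B => dominant e f B w) K hcore vN
    (fun B X aB oX => dominant_add_shares vf aB oX) aS (dS w wD).
have [aB _] := iter_core_ind (Q := fun _ => True) K hcore vN (fun _ _ _ _ _ => I) aS I.
apply: IH => /=; first by rewrite -ltnS -cN.
split; last first.
  have KN : (K <= 2 * #|N|)%N by apply: num_calls_le; rewrite cN.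
  have NV : (#|N| <= #|V|)%N by apply: max_card.
  apply: leq_trans calls; rewrite -/N -addnA leq_add2l [X in (_ <= 2 * (_ * X))%N]cN.
  by rewrite mulnS mulnDr leq_add2r (leq_trans KN) // leq_mul2l.
split=> //=.
- by rewrite inE rD orbT.
(* Agents of [N] are preserved by envy-freeness; the others are dominant, hence locally
   proportional. *)
- move=> w; have [wN|wN] := boolP (w \in N).
    by have [] := iter_core_ind (Q := fun B => loc_prop_at e f B w) K hcore vN
      (fun B X aB oX => loc_prop_add_shares vf aB oX wN) aS (lS w).
  apply: (dominant_loc_prop vf aB); apply: domB.
  by move: wN; rewrite !inE negbK => ->; rewrite orbT.
(* If adding [v] fills [V], then [v] was alone in [N]. *)
- move=> DvT; apply: (iter_core_complete hcore vN _ aS).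
  by rewrite cN DvT finset.setCT cards0.
Qed.
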